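(* Let $n\ge1$, $N=2^n$, and let $E_{ij}$ ($1\le i,j\le N$) be the $N\times N$ matrix with a single non-zero entry, equal to $1$, in row $i$ and column $j$. For $i\neq j$ the following hold in a system of $n$ spins-$\frac12$: (1) for any $E_{ij}$ there is an element of the torus of the form $T=\exp\big(-i\,\mathrm{diag}(\theta_1,\dots,\theta_N)\big)$ with $\operatorname{Ad}_T(E_{ij})=-E_{ij}$; (2) any $E_{ij}$ can also be sign-inverted by a single local $z$-rotation, i.e. there are a qubit $\ell\in\{1,\dots,n\}$ and an angle $\phi\in\mathbb R$ such that $K=\exp(-i\tfrac{\phi}{2}\tilde\sigma_{\ell z})$ satisfies $KE_{ij}K^{-1}=-E_{ij}$; (3) in contrast, $E_{ij}$ can be sign-inverted by a joint local $z$-rotation on all $n$ spins, i.e. by some $K=\exp(-i\phi F_z)$ with $\phi\in\mathbb R$ and $KE_{ij}K^{-1}=-E_{ij}$, only if the $n$-digit binary representations of $i-1$ and $j-1$ do not have the same number of $0$'s and $1$'s (irrespective of the order).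
   Context: $\operatorname{Ad}_T(X):=TXT^{-1}$. The torus is the one of $\mathbf{SU}(N)$, i.e. $\theta_1,\dots,\theta_N\in\mathbb R$ with $\sum_\ell\theta_\ell=0$. $\tilde\sigma_{\ell z}:=\mathbf 1_2^{\otimes(\ell-1)}\otimes\sigma_z\otimes\mathbf 1_2^{\otimes(n-\ell)}$ with $\sigma_z=\mathrm{diag}(1,-1)$, and $F_z:=\frac12\sum_{\ell=1}^n\tilde\sigma_{\ell z}$. *)

(* Defs.v *)
From HB Require Import structures.
From mathcomp Require Import all_boot all_order all_algebra.
From mathcomp Require Import all_classical all_reals all_analysis.
From mathcomp Require Import complex mxtens.

Set Implicit Arguments.
Unset Strict Implicit.
Unset Printing Implicit Defensive.

Import Order.TTheory GRing.Theory Num.Theory.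
Import numFieldNormedType.Exports.
Local Open Scope classical_set_scope.
Local Open Scope ring_scope.

(* Complex numbers are R[i] over an arbitrary realType R.
   Indices are 0-based: i : 'I_(2 ^ n) is the row or column written "i + 1" in
   the 1-based numbering, and l : 'I_n is qubit number l + 1. *)

Definition expmx (K : numFieldType) (N : nat) (A : 'M[K]_N) : 'M[K]_N :=
  lim (series (fun k : nat => (k`!%:R)^-1 *: A ^+ k) @ \oo).

Definition Ad (K : numFieldType) (N : nat) (T X : 'M[K]_N) : 'M[K]_N :=
  T *m X *m invmx T.

Definition SU_torus (R : realType) (N : nat) : set 'M[R[i]]_N :=
  [set T | exists theta : 'I_N -> R, \sum_(l < N) theta l = 0 /\
     T = expmx (- 'i%C *: diag_mx (\row_(l < N) (theta l)%:C%C))].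

Definition sigma_z (R : realType) : 'M[R[i]]_2 :=
  diag_mx (\row_(k < 2) (if k == ord0 then 1 else -1)).

Lemma expn2_split (n : nat) (l : 'I_n) :
  (2 ^ l * 2 * 2 ^ (n - l.+1) = 2 ^ n)%N.
Proof. by rewrite -expnSr -expnD subnKC. Qed.

(* The three-fold product has size 2 ^ l * 2 * 2 ^ (n - l - 1), hence the cast.
   The index of A *t B attached to the pair (i, j) is i * (size of B) + j, so
   qubit l carries the l-th most significant binary digit of the index. *)
Definition sigma_z_at (R : realType) (n : nat) (l : 'I_n) : 'M[R[i]]_(2 ^ n) :=
  castmx (expn2_split l, expn2_split l)
    ((1%:M : 'M[R[i]]_2) ^t l *t sigma_z R
       *t (1%:M : 'M[R[i]]_2) ^t (n - l.+1)).

Definition F_z (R : realType) (n : nat) : 'M[R[i]]_(2 ^ n) :=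
  2^-1 *: \sum_(l < n) sigma_z_at R l.

(* Most significant digit first, padded with leading zeros. *)
Definition binary_digits (n m : nat) : n.-tuple nat :=
  [tuple (m %/ 2 ^ (n - k.+1) %% 2)%N | k < n].

(* Main.v *)
(* A diagonal T = diag(t_1, ..., t_N) acts on E_ij by the scalar t_i / t_j.  When
   T = exp(-i diag(theta_k)) this scalar is e^{-i(theta_i - theta_j)}, which is -1
   as soon as theta_i - theta_j = +-pi, and is 1 when theta_i = theta_j.
   The k-th diagonal entry of sigma_{l z} is the sign (-1)^(l-th binary digit
   of k), so (2) only requires a digit in which i and j differ, and the k-th entry
   of 2 F_z is the number of zeros minus the number of ones among the digits. *)
Require Import Defs.
From HB Require Import structures.
From mathcomp Require Import all_boot all_order all_algebra.
From mathcomp Require Import all_classical all_reals all_analysis.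
From mathcomp Require Import complex mxtens ring.
Import Order.TTheory GRing.Theory Num.Theory.
Import numFieldNormedType.Exports.
Local Open Scope classical_set_scope.
Local Open Scope ring_scope.

Lemma diag_mxX (R : pzRingType) (N : nat) (d : 'rV[R]_N) (k : nat) :
  diag_mx d ^+ k = diag_mx (\row_j (d 0 j ^+ k)).
Proof.
elim: k => [|k IHk].
  by apply/matrixP => i j; rewrite expr0 !mxE.
rewrite exprSr IHk -[LHS]/(diag_mx _ *m diag_mx d) mulmx_diag.
by congr diag_mx; apply/rowP => j; rewrite !mxE exprSr.
Qed.

(** A ball of matrices is a product of balls around the entries, and finitely many eventual
    conditions hold eventually together. *)
Lemma cvg_mx (K : numFieldType) (m n : nat) (u : nat -> 'M[K]_(m, n))
    (A : 'M[K]_(m, n)) :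
  (forall i j, u k i j @[k --> \oo] --> A i j) -> u k @[k --> \oo] --> A.
Proof.
move=> uA; apply/cvg_ballP => e e_gt0.
have : \forall k \near \oo, forall i j, ball (A i j) e (u k i j).
  apply: filter_forall => i; apply: filter_forall => j.
  by have /cvg_ballP := uA i j; apply.
by apply: filterS => k ?; split.
Qed.

(** Powers of a diagonal matrix are entrywise, so each partial sum is diagonal. The limits [e] enter
    as data because the scalar series need not converge over an arbitrary [numFieldType]. *)
Lemma expmx_diag (K : numFieldType) (N : nat) (d e : 'rV[K]_N) :
  (forall j, series (fun k => (k`!%:R)^-1 * d 0 j ^+ k) @ \oo --> e 0 j) ->
  expmx (diag_mx d) = diag_mx e.
Proof.
move=> de; apply: cvg_lim; first exact: norm_hausdorff.
apply: cvg_mx => i j; rewrite !mxE.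
have serE k : series (fun k => (k`!%:R)^-1 *: diag_mx d ^+ k) k i j
    = series (fun k => (k`!%:R)^-1 * d 0 i ^+ k) k *+ (i == j).
  rewrite /series /= summxE -sumrMnl; apply: eq_bigr => l _.
  by rewrite diag_mxX !mxE -mulrnAr.
rewrite (eq_cvg _ _ serE).
case: eqVneq => [_|_]; first exact: de.
exact: cvg_cst.
Qed.

(* The cast is needed because R[i] gets its topology from its numFieldType
   structure only. *)
Lemma cvg_real_complex (R : realType) (u : nat -> R) (a : R) :
  u k @[k --> \oo] --> a ->
  ((u k)%:C%C : (R[i] : numFieldType)) @[k --> \oo]
    --> (a%:C%C : (R[i] : numFieldType)).
Proof.
move=> /cvgrPdist_lt ua; apply/cvgrPdist_lt => e e_gt0.
(* Positive elements of [R[i]] are real, so the radius [e] comes from [R]. *)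
have eE : e = (complex.Re e)%:C%C by rewrite complex.RRe_real ?gtr0_real.
have Re_gt0 : 0 < complex.Re e by rewrite eE complex.ltcR in e_gt0.
apply: filterS (ua _ Re_gt0) => k.
rewrite -rmorphB eE complex.normc_def /= expr0n addr0 sqrtr_sqr.
by rewrite complex.ltcR.
Qed.

(* e^{-ix} *)
Definition expiN (R : realType) (x : R) : R[i] :=
  (cos x)%:C%C - 'i%C * (sin x)%:C%C.

(** Even powers of -i are signs and odd ones are signs times -i, while [cos_coeff] vanishes at odd
    [k] and [sin_coeff] at even [k]. *)
Lemma expiN_coeff (R : realType) (x : R) (k : nat) :
  (k`!%:R)^-1 * (- 'i%C * x%:C%C) ^+ k
    = (cos_coeff x k)%:C%C - 'i%C * (sin_coeff x k)%:C%C :> R[i].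
Proof.
have ii : (- 'i%C : R[i]) ^+ 2 = -1 by rewrite sqrrN complex.sqr_i.
have powi : (- 'i%C : R[i]) ^+ k = (-1) ^+ odd k./2 * (- 'i%C) ^+ odd k.
  by rewrite -[in LHS](odd_double_half k) exprD -mul2n exprM ii signr_odd mulrC.
rewrite /cos_coeff /sin_coeff /= -exprnP exprMn powi.
rewrite !rmorphM /= !rmorph_nat fmorphV rmorph_nat !rmorphXn !rmorphN1.
rewrite -[in RHS]signr_odd -[(-1) ^+ k.-1./2]signr_odd.
have [ok|ek] := boolP (odd k) => /=.
- have -> : k.-1./2 = k./2.
    by case: k ok {powi} => //= k; rewrite uphalf_half => /negbTE ->.
  rewrite expr1 !mul0r mul1r sub0r; move: (_^-1) (_ ^+ _) (_ ^+ _) => a b c.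
  by rewrite mulrA mulrN mulrC !mulrA; ring.
- by rewrite expr0 mul1r !mul0r mulr0 subr0 mulr1 mulrC.
Qed.

Lemma cvg_series_expiN (R : realType) (x : R) :
  series (fun k => (k`!%:R)^-1 * (- 'i%C * x%:C%C) ^+ k : (R[i] : numFieldType)) @ \oo
    --> (expiN R x : (R[i] : numFieldType)).
Proof.
have serE k : series (fun k => (k`!%:R)^-1 * (- 'i%C * x%:C%C) ^+ k) k
    = (series (cos_coeff x) k)%:C%C - 'i%C * (series (sin_coeff x) k)%:C%C :> R[i].
  rewrite /series /= !rmorph_sum mulr_sumr -sumrB.
  by apply: eq_bigr => l _; rewrite expiN_coeff.
have {}serE := funext serE; rewrite serE.
have cosC := cvg_real_complex _ _ _ (@is_cvg_series_cos_coeff R x).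
have sinC := cvg_real_complex _ _ _ (@is_cvg_series_sin_coeff R x).
(* [cos] and [sin] are defined as the limits of these two series. *)
rewrite /expiN trigo.cos.unlock trigo.sin.unlock.
have isinC := @cvgMr (R[i] : numFieldType) _ _ _ _ 'i%C _ sinC.
exact: (cvgB cosC (isinC _)).
Qed.

Lemma expmxNi_diag (R : realType) (N : nat) (theta : 'I_N -> R) :
  expmx (- 'i%C *: diag_mx (\row_j (theta j)%:C%C))
    = diag_mx (\row_j expiN R (theta j)).
Proof.
rewrite -linearZ; apply: expmx_diag => j; rewrite !mxE.
exact: cvg_series_expiN.
Qed.

Lemma expiND (R : realType) (x y : R) : expiN R (x + y) = expiN R x * expiN R y.
Proof.
have ii : 'i%C * 'i%C = -1 :> R[i] by rewrite -expr2 complex.sqr_i.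
rewrite /expiN cosD sinD rmorphB rmorphD !rmorphM /=.
by ring: ii.
Qed.

Lemma expiN0 (R : realType) : expiN R 0 = 1.
Proof. by rewrite /expiN cos0 sin0 mulr0 subr0. Qed.

(** Common tool for the three claims: each exponential involved has -i times a real diagonal matrix
    as exponent. *)
Lemma Ad_expmxNi (R : realType) (N : nat) (theta : 'I_N -> R) (i j : 'I_N) :
  Ad (expmx (- 'i%C *: diag_mx (\row_j (theta j)%:C%C))) (delta_mx i j)
    = expiN R (theta i - theta j) *: delta_mx i j.
Proof.
pose T t := diag_mx (\row_j expiN R (t j)) : 'M[R[i]]_N.
(* Negating the angles gives the inverse; [invmx] agrees with it once [T theta] is known to be a
   unit. *)
have TN : T theta *m T (fun j => - theta j) = 1%:M.
  rewrite mulmx_diag; apply/matrixP => k l; rewrite !mxE.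
  by rewrite -expiND subrr expiN0.
rewrite expmxNi_diag -/(T theta) /Ad.
have /mulmx1_unit[Tu _] := TN.
have -> : invmx (T theta) = T (fun j => - theta j).
  by rewrite -[LHS]mulmx1 -TN mulmxA mulVmx ?mul1mx.
rewrite mul_diag_mx mul_mx_diag; apply/matrixP => k l; rewrite !mxE expiND.
case: eqVneq => [->|_]; case: eqVneq => [->|_] //=; rewrite ?(mulr0, mul0r) //.
by rewrite !mulr1.
Qed.

Lemma expiN_pi (R : realType) : expiN R pi = -1.
Proof. by rewrite /expiN cospi sinpi mulr0 subr0 rmorphN1. Qed.

Lemma expiN_Npi (R : realType) : expiN R (- pi) = -1.
Proof. by rewrite /expiN cosN sinN cospi sinpi oppr0 mulr0 subr0 rmorphN1. Qed.

Lemma tensmx_diag (R : pzRingType) (m n : nat) (d : 'rV[R]_m) (e : 'rV[R]_n) :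
  diag_mx d *t diag_mx e =
    diag_mx (\row_k (d 0 (mxtens_unindex k).1 * e 0 (mxtens_unindex k).2)).
Proof.
apply/matrixP => i j.
case: (mxtens_indexP i) => i1 i2; case: (mxtens_indexP j) => j1 j2.
rewrite tensmxE !mxE !mxtens_indexK (can_eq (@mxtens_indexK m n)) xpair_eqE.
by rewrite mulrnAl mulrnAr -mulrnA -mulnb mulnC.
Qed.

Lemma ntensmx_1 (R : pzRingType) (m k : nat) : (1%:M : 'M[R]_m) ^t k = 1%:M.
Proof.
case: k => [//|]; elim=> [//|k IHk].
rewrite ntensmxSS IHk -!diag_const_mx tensmx_diag; congr diag_mx.
by apply/rowP => i; rewrite !mxE mulr1.
Qed.

Lemma castmx_diag (R : pzRingType) (m n : nat) (e : m = n) (d : 'rV[R]_m) :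
  castmx (e, e) (diag_mx d) = diag_mx (castmx (erefl 1%N, e) d).
Proof. by case: n / e. Qed.

(** Digit [l] counts from the most significant one, hence the weight [2 ^ (n - l.+1)]. The values
    lie in [R] so that they can serve as angles. *)
Definition spin_sign (R : realType) (n l k : nat) : R :=
  if odd (k %/ 2 ^ (n - l.+1)) then -1 else 1.

(** The identity factors contribute 1, the middle tensor index of [k] is [k %/ 2 ^ (n - l.+1) %% 2],
    and the cast keeps the value of the index. *)
Lemma sigma_z_atE (R : realType) (n : nat) (l : 'I_n) :
  sigma_z_at R l = diag_mx (\row_k (spin_sign R n l k)%:C%C).
Proof.
rewrite /sigma_z_at /sigma_z !ntensmx_1 -!diag_const_mx !tensmx_diag castmx_diag.
congr diag_mx; apply/rowP => k; rewrite castmxE !mxE mul1r mulr1 /spin_sign.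
rewrite -val_eqE /= modn2; case: odd => /=; last by rewrite rmorph1.
by rewrite rmorphN1.
Qed.

Lemma count_mktuple (T : Type) (n : nat) (a : pred T) (f : 'I_n -> T) :
  count a [tuple f k | k < n] = (\sum_(k < n) a (f k))%N.
Proof. by rewrite /= count_map -sum1_count big_mkcond /= big_enum. Qed.

Lemma sum_spin_sign (R : realType) (n k : nat) :
  \sum_(l < n) spin_sign R n l k =
    (count_mem 0%N (binary_digits n k))%:R - (count_mem 1%N (binary_digits n k))%:R.
Proof.
rewrite !count_mktuple !natr_sum -sumrB; apply: eq_bigr => l _.
by rewrite /spin_sign modn2; case: odd; rewrite /= ?sub0r ?subr0.
Qed.

Lemma F_zE (R : realType) (n : nat) :
  F_z R n = diag_mx (\row_k
    (((count_mem 0%N (binary_digits n k))%:R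
      - (count_mem 1%N (binary_digits n k))%:R) / 2)%:C%C).
Proof.
apply/matrixP => i j; rewrite /F_z !mxE summxE -sum_spin_sign.
under eq_bigr do rewrite sigma_z_atE !mxE.
rewrite sumrMnl mulrnAr mulrC; congr (_ *+ _).
by rewrite rmorphM fmorphV rmorph_nat rmorph_sum.
Qed.

(** Induction on [n] strips the least significant digit; the digits of the halves are the remaining
    ones, shifted by one. *)
Lemma odd_divn_inj (n i j : nat) : (i < 2 ^ n)%N -> (j < 2 ^ n)%N ->
  (forall l, (l < n)%N -> odd (i %/ 2 ^ l) = odd (j %/ 2 ^ l)) -> i = j.
Proof.
elim: n i j => [|n IHn] i j; first by rewrite expn0 !ltnS !leqn0 => /eqP-> /eqP->.
rewrite expnSr => ilt jlt ij.
rewrite -(odd_double_half i) -(odd_double_half j) -!divn2.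
have := ij 0%N isT; rewrite expn0 !divn1 => ->; congr (_ + _.*2)%N.
apply: IHn; rewrite ?ltn_divLR // => l ln.
by rewrite -!divnMA -expnS; exact: ij.
Qed.

Lemma neq_spin_sign (R : realType) (n : nat) (i j : 'I_(2 ^ n)) : i <> j ->
  exists l : 'I_n, spin_sign R n l i = - spin_sign R n l j.
Proof.
move=> ij.
have [/existsP[l dl]|/existsPn same] :=
    boolP [exists l : 'I_n, odd (i %/ 2 ^ (n - l.+1)) != odd (j %/ 2 ^ (n - l.+1))].
  by exists l; move: dl; rewrite /spin_sign; do 2![case: odd] => //; rewrite opprK.
case: ij; apply: val_inj; apply: (odd_divn_inj n) (ltn_ord i) (ltn_ord j) _ => l ln.
(* [same] counts digits from the most significant one and [odd_divn_inj] from the least; [rev_ord]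
   converts. *)
by have /negPn/eqP := same (rev_ord (Ordinal ln)); rewrite /= subnSK // subKn // ltnW.
Qed.

(** Absorbs a rotation angle into the diagonal, the form that [Ad_expmxNi] expects. *)
Lemma scale_diag_real (R : realType) (N : nat) (c : R) (s : 'I_N -> R) :
  - 'i%C * c%:C%C *: diag_mx (\row_k (s k)%:C%C)
    = - 'i%C *: diag_mx (\row_k (c * s k)%:C%C).
Proof.
rewrite -scalerA; congr (_ *: _); rewrite -linearZ; congr diag_mx.
by apply/rowP => k; rewrite !mxE rmorphM.
Qed.

Theorem proposition1 (R : realType) (n : nat) (hn : (1 <= n)%N)
    (i j : 'I_(2 ^ n)) (hij : i <> j) :
  [/\ exists T : 'M[R[i]]_(2 ^ n),
        SU_torus T /\ Ad T (delta_mx i j) = - delta_mx i j,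
      exists (l : 'I_n) (phi : R),
        Ad (expmx (- 'i%C * (phi / 2)%:C%C *: sigma_z_at R l)) (delta_mx i j)
          = - delta_mx i j
    & (exists phi : R,
        Ad (expmx (- 'i%C * phi%:C%C *: F_z R n)) (delta_mx i j)
          = - delta_mx i j) ->
      ~ (count_mem 0%N (binary_digits n i) = count_mem 0%N (binary_digits n j) /\
         count_mem 1%N (binary_digits n i) = count_mem 1%N (binary_digits n j))].
move: hij => /eqP ij.
split.
(* Angles pi/2 at [i], -pi/2 at [j] and 0 elsewhere sum to zero, and those at [i] and [j] differ by
   pi. *)
- pose theta (k : 'I_(2 ^ n)) : R := pi / 2 * ((k == i)%:R - (k == j)%:R).
  exists (expmx (- 'i%C *: diag_mx (\row_k (theta k)%:C%C))); split.
    exists theta; split=> //; rewrite -mulr_sumr sumrB.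
    have sum_eq k0 : \sum_(k < 2 ^ n) (k == k0)%:R = 1 :> R.
      by rewrite (bigD1 k0) //= eqxx big1 ?addr0// => k /negbTE->.
    by rewrite !sum_eq subrr mulr0.
  rewrite Ad_expmxNi /theta !eqxx (negbTE ij) eq_sym (negbTE ij).
  have -> : pi / 2 * (1%:R - 0%:R) - pi / 2 * (0%:R - 1%:R) = pi :> R by field.
  by rewrite expiN_pi scaleN1r.
- have [l sl] := neq_spin_sign R n i j (elimN eqP ij).
  (* With opposite signs at [i] and [j], the half angle pi/2 gives phases that differ by pi or
     -pi. *)
  exists l, pi; rewrite sigma_z_atE scale_diag_real Ad_expmxNi sl.
  have -> : pi / 2 * - spin_sign R n l j - pi / 2 * spin_sign R n l j
      = pi * - spin_sign R n l j by field.
  rewrite /spin_sign; case: odd; rewrite ?opprK ?mulr1 ?mulrN1.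
    by rewrite expiN_pi scaleN1r.
  by rewrite expiN_Npi scaleN1r.
- move=> [phi]; rewrite F_zE scale_diag_real Ad_expmxNi => /matrixP/(_ i j) + [c0 c1].
  (* Equal counts make the phase difference 0, so entry [(i, j)] would read 1 = -1, impossible in
     characteristic 0. *)
  rewrite c0 c1 subrr expiN0 scale1r !mxE !eqxx => /eqP.
  by rewrite -subr_eq0 opprK -natrD pnatr_eq0.
Qed.
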